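(* Let $\boldsymbol{V}\in\mathbb{R}^{n\times p}$ have full column rank $p<n$, and let $\boldsymbol{A}\in\mathbb{R}^{n\times n}$ be a symmetric matrix of full rank $n$ such that $\boldsymbol{A}+\varepsilon^{-1}\boldsymbol{V}\boldsymbol{V}^\top$ is positive semi-definite for all sufficiently small $\varepsilon>0$. Let $\mathcal{X}_\varepsilon\sim DPP(\boldsymbol{A}+\varepsilon^{-1}\boldsymbol{V}\boldsymbol{V}^\top)$. Then, as $\varepsilon\to0$ ($\varepsilon>0$), $\mathcal{X}_\varepsilon$ converges to $\mathcal{X}_\star\sim DPP(\boldsymbol{A};\boldsymbol{V})$.
   Context: The ground set is $\Omega\cong\{1,\dots,n\}$. $\boldsymbol{M}_X$ denotes the submatrix with rows and columns in $X$, $\boldsymbol{M}_{X,:}$ the submatrix of rows in $X$. L-ensemble: for $\boldsymbol{L}$ positive semi-definite, $\mathcal{X}\sim DPP(\boldsymbol{L})$ means $\mathbf{P}(\mathcal{X}=X)\propto\det(\boldsymbol{L}_X)$ for all $X\subseteq\Omega$, with $\det\boldsymbol{L}_\varnothing=1$. Partial-projection DPP (extended L-ensemble): for $\boldsymbol{L}$ symmetric and $\boldsymbol{V}\in\mathbb{R}^{n\times p}$ of full column rank such that $\boldsymbol{x}^\top\boldsymbol{L}\boldsymbol{x}\ge0$ whenever $\boldsymbol{V}^\top\boldsymbol{x}=0$ (a ''nonnegative pair''), $\mathcal{X}\sim DPP(\boldsymbol{L};\boldsymbol{V})$ means $$\mathbf{P}(\mathcal{X}=X)\propto(-1)^p\det\begin{pmatrix}\boldsymbol{L}_X&\boldsymbol{V}_{X,:}\\(\boldsymbol{V}_{X,:})^\top&\boldsymbol{0}\end{pmatrix}\quad\text{for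 all }X\subseteq\Omega.$$ Convergence: $\mathcal{X}_\varepsilon$ converges to $\mathcal{X}_\star$ if $\mathbf{P}(\mathcal{X}_\varepsilon=X)\to\mathbf{P}(\mathcal{X}_\star=X)$ for every $X\subseteq\Omega$. *)

(* Defs.v *)
From HB Require Import structures.
From mathcomp Require Import all_boot all_order all_algebra.
From mathcomp Require Import all_classical all_reals all_analysis.
Import Order.TTheory GRing.Theory Num.Theory.
Import numFieldNormedType.Exports.

Set Implicit Arguments.
Unset Strict Implicit.
Unset Printing Implicit Defensive.

Local Open Scope classical_set_scope.
Local Open Scope ring_scope.

(* Subsets of the ground set, with the power-set sigma-algebra, so that random
   subsets are the library's random variables [{RV P >-> subsets n}]. *)
Definition subsets (n : nat) : Type := {set 'I_n}.

HB.instance Definition _ (n : nat) := Finite.on (subsets n).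
HB.instance Definition _ (n : nat) := isPointed.Build (subsets n) (@finset.set0 'I_n).
HB.instance Definition _ (n : nat) := @isMeasurable.Build default_measure_display
  (subsets n) discrete_measurable discrete_measurable0
  discrete_measurableC discrete_measurableU.

Section Matrices.
Context {R : realType} {n : nat}.

Definition quad_form (M : 'M[R]_n) (x : 'cV[R]_n) : R := (x^T *m M *m x) 0 0.

Definition psd (M : 'M[R]_n) : Prop :=
  M^T = M /\ forall x : 'cV[R]_n, 0 <= quad_form M x.

Definition full_col_rank {p : nat} (V : 'M[R]_(n, p)) : Prop := \rank V = p.

Definition nonneg_pair {p : nat} (L : 'M[R]_n) (V : 'M[R]_(n, p)) : Prop :=
  [/\ L^T = L, full_col_rank V &
      forall x : 'cV[R]_n, V^T *m x = 0 -> 0 <= quad_form L x].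

(* [enum_val] lists the elements of [X] in increasing order. *)
Definition principal_submx (M : 'M[R]_n) (X : {set 'I_n}) : 'M[R]_#|X| :=
  mxsub (@enum_val _ (mem X)) (@enum_val _ (mem X)) M.

Definition row_submx {p : nat} (V : 'M[R]_(n, p)) (X : {set 'I_n}) :
    'M[R]_(#|X|, p) :=
  rowsub (@enum_val _ (mem X)) V.

Definition bordered_submx {p : nat} (L : 'M[R]_n) (V : 'M[R]_(n, p))
    (X : {set 'I_n}) : 'M[R]_(#|X| + p) :=
  block_mx (principal_submx L X) (row_submx V X) (row_submx V X)^T 0.

End Matrices.

Section RandomSubsets.
Context {R : realType} {n : nat}.

Definition mass {d : measure_display} {T : measurableType d}
    {P : probability T R} (X : {RV P >-> subsets n}) (S : {set 'I_n}) : \bar R :=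
  P (X @^-1` [set (S : subsets n)]).

(* The constant is forced to be the inverse of the sum of the weights, because
   the masses sum to 1. *)
Definition mass_proportional_to {d : measure_display} {T : measurableType d}
    {P : probability T R} (X : {RV P >-> subsets n}) (w : {set 'I_n} -> R) : Prop :=
  exists c : R, forall S : {set 'I_n}, mass X S = (c * w S)%:E.

Definition is_DPP {d : measure_display} {T : measurableType d}
    {P : probability T R} (X : {RV P >-> subsets n}) (L : 'M[R]_n) : Prop :=
  psd L /\ mass_proportional_to X (fun S => \det (principal_submx L S)).

Definition is_partial_projection_DPP {p : nat} {d : measure_display}
    {T : measurableType d} {P : probability T R} (X : {RV P >-> subsets n})
    (L : 'M[R]_n) (V : 'M[R]_(n, p)) : Prop :=
  nonneg_pair L V /\
  mass_proportional_to X (fun S => (-1) ^+ p * \det (bordered_submx L V S)).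

(* The random subsets of the family may live on different probability spaces. *)
Definition cvg_in_law_at_0 {d : R -> measure_display}
    {T : forall e, measurableType (d e)} {P : forall e, probability (T e) R}
    (X : forall e, {RV (P e) >-> subsets n})
    {d' : measure_display} {T' : measurableType d'} {P' : probability T' R}
    (X' : {RV P' >-> subsets n}) : Prop :=
  forall S : {set 'I_n}, mass (X e) S @[e --> 0^'+] --> mass X' S.

End RandomSubsets.

(* Main.v *)
Require Import Defs.
From mathcomp Require Import all_boot all_order all_algebra.
From mathcomp Require Import all_classical all_reals all_analysis.
Import Order.TTheory GRing.Theory Num.Theory.
Import numFieldNormedType.Exports.

Local Open Scope classical_set_scope.
Local Open Scope ring_scope.

(** Both laws are normalizations of weights on the subsets [S], so it suffices
    to compare weights up to a factor that is independent of [S].  Eliminating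
    the corner of a bordered matrix gives
<<
      e^p det (A_S + e^-1 V_S V_S^T) = (-1)^p det [A_S, V_S; V_S^T, - e I_p]
>>
    ([det_bordered_shift]): after the rescaling by [e^p], the weights of the
    L-ensemble are polynomials in [e], and at [e = 0] they are the weights [w]
    of the partial-projection DPP ([cvg_scaled_weight]).  The factor [e^p]
    cancels when the weights are divided by their sum, and the quotients
    converge as soon as the sum of the [w S] is nonzero.

    If a random subset with weights [w] is given, that sum is nonzero because
    its masses add up to 1.  For such a random subset to exist, the [w S] must
    be nonnegative and not all zero.  They are limits of rescaled L-ensemble
    weights, which are nonnegative: they are proportional to probabilities, with
    a positive factor because the empty set has weight 1 ([DPP_weight_ge0]).
    And [w S] is nonzero when the rows of [V] in [S] form a basis of the row
    space, because then [w S] is the square of the determinant of [V_S]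
    ([exists_det_bordered_neq0]). *)

(** * Determinants of bordered matrices *)

(** Adding to the columns of the first block the columns of the second one,
    multiplied by [e^-1 B^T], clears the lower left block and leaves the Schur
    complement of the corner [- e I_p]. *)
Lemma det_bordered_shift (F : fieldType) (m p : nat) (L : 'M[F]_m)
    (B : 'M[F]_(m, p)) (e : F) : e != 0 ->
  (-1) ^+ p * \det (block_mx L B B^T (- e)%:M) =
  e ^+ p * \det (L + e^-1 *: (B *m B^T)).
Proof.
move=> e0.
have elim_corner : block_mx L B B^T (- e)%:M *m block_mx 1%:M 0 (e^-1 *: B^T) 1%:M
    = block_mx (L + e^-1 *: (B *m B^T)) B 0 (- e)%:M.
  rewrite mulmx_block !mulmx0 !mulmx1 !add0r -scalemxAr mul_scalar_mx scalerA.
  by rewrite mulNr mulfV// scaleN1r subrr.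
have := congr1 determinant elim_corner.
rewrite det_mulmx det_lblock !det1 !mulr1 => ->.
by rewrite det_ublock det_scalar mulrCA -exprMn mulN1r opprK mulrC.
Qed.

(** The determinant is the value at [e] of a polynomial, namely of the same
    determinant with the corner [- 'X]. *)
Lemma cvg_det_bordered_shift (R : realType) (m p : nat) (L : 'M[R]_m)
    (B : 'M[R]_(m, p)) :
  \det (block_mx L B B^T (- e)%:M) @[e --> (0 : R)] --> \det (block_mx L B B^T 0).
Proof.
pose q := \det (block_mx (map_mx polyC L) (map_mx polyC B) (map_mx polyC B^T)
                         (- 'X)%:M).
have qE e : \det (block_mx L B B^T (- e)%:M) = q.[e].
  rewrite -[q.[e]]/(horner_eval e q) -det_map_mx map_block_mx map_scalar_mx/=.
  have mapK a b (M : 'M[R]_(a, b)) : map_mx (horner_eval e) (map_mx polyC M) = M.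
    by apply/matrixP => i j; rewrite !mxE /horner_eval hornerC.
  by rewrite !mapK /horner_eval hornerN hornerX.
have -> : \det (block_mx L B B^T 0) = q.[0].
  by rewrite -qE oppr0 raddf0.
under eq_fun do rewrite qE.
exact: continuous_horner.
Qed.

Lemma principal_submx_low_rank (R : realType) (n p : nat) (A : 'M[R]_n)
    (V : 'M[R]_(n, p)) (a : R) (S : {set 'I_n}) :
  principal_submx (A + a *: (V *m V^T)) S =
  principal_submx A S + a *: (row_submx V S *m (row_submx V S)^T).
Proof.
apply/matrixP => i j; rewrite !mxE; congr (_ + _ * _).
by apply: eq_bigr => k _; rewrite !mxE.
Qed.

Lemma cvg_scaled_weight (R : realType) (n p : nat) (A : 'M[R]_n)
    (V : 'M[R]_(n, p)) (S : {set 'I_n}) :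
  e ^+ p * \det (principal_submx (A + e^-1 *: (V *m V^T)) S) @[e --> 0^'+]
    --> (-1) ^+ p * \det (bordered_submx A V S).
Proof.
pose B := row_submx V S; pose L := principal_submx A S.
apply: (@cvg_trans _ ((-1) ^+ p * \det (block_mx L B B^T (- e)%:M) @[e --> 0^'+])).
  apply: near_eq_cvg; near=> e.
  by rewrite principal_submx_low_rank det_bordered_shift// gt_eqF.
apply: cvgMr.
by apply: cvg_at_right_filter; exact: cvg_det_bordered_shift.
Unshelve. all: by end_near. Qed.

(** A vector [(u, v)] of the left kernel satisfies [u B = 0], which forces
    [u = 0], and then [v B^T = 0], which forces [v = 0]. The two rank conditions
    say that [B] is invertible; stating them separately leaves the number of
    rows a variable such as [#|S|], equal to [p] only up to a proof. *)
Lemma det_square_border_neq0 (F : fieldType) (m p : nat) (L : 'M[F]_m)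
    (B : 'M[F]_(m, p)) : row_free B -> row_full B ->
  \det (block_mx L B B^T 0) != 0.
Proof.
move=> freeB fullB.
rewrite -unitfE -unitmxE -row_free_unit; apply: inj_row_free => v.
rewrite -{1}[v]hsubmxK mul_row_block mulmx0 addr0 -[X in _ = X -> _]row_mx0.
move=> /eq_row_mx[uv u0].
have {}u0 : lsubmx v = 0 by apply: (row_free_inj freeB); rewrite u0 mul0mx.
move: uv; rewrite u0 mul0mx add0r => v0.
have freeBT : row_free B^T by rewrite /row_free mxrank_tr.
have {}v0 : rsubmx v = 0 by apply: (row_free_inj freeBT); rewrite v0 mul0mx.
by rewrite -[v]hsubmxK u0 v0 row_mx0.
Qed.

(** Choose for [S] the indices of [p] linearly independent rows of [V]. *)
Lemma exists_det_bordered_neq0 {R : realType} {n p : nat} (A : 'M[R]_n)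
    {V : 'M[R]_(n, p)} : full_col_rank V ->
  exists S : {set 'I_n}, \det (bordered_submx A V S) != 0.
Proof.
move=> rankV; have fullV : row_full V by rewrite /row_full rankV.
pose f := fullrankfun fullV; pose S := [set f i | i in 'I_p]%SET.
exists S.
have cardS : #|S| = p by rewrite card_imset ?card_ord//; exact: fullrankfun_inj.
have fullB : row_full (row_submx V S).
  rewrite -sub1mx; apply: (submx_trans (B := rowsub f V)).
    by rewrite sub1mx; exact: fullrowsub_full.
  apply/row_subP => i; have fS : f i \in S by exact: imset_f.
  rewrite (eq_row_sub (enum_rank_in fS (f i)))// row_rowsub.
  by rewrite enum_rankK_in// row_rowsub.
apply: det_square_border_neq0 => //.
by move: fullB; rewrite /row_free /row_full => /eqP ->; rewrite cardS.
Qed.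

(** * Laws given by weights *)

Lemma sum_mass {R : realType} {n : nat} {d : measure_display}
    {T : measurableType d} {P : probability T R} (X : {RV P >-> subsets n}) :
  (\sum_(S : {set 'I_n}) mass X S = 1)%E.
Proof.
transitivity (\sum_(S \in [set: subsets n]) P (X @^-1` [set S]))%E.
  rewrite fsbig_seq ?index_enum_uniq//; apply: eq_fsbigl.
  by apply/seteqP; split => // S _ /=; rewrite mem_index_enum.
rewrite -measure_fin_bigcup//.
- rewrite -(@probability_setT _ _ _ P); congr (P _).
  by apply/seteqP; split => // x _; exists (X x).
- exact: (@finite_finset (subsets n)).
- exact: trivIset_preimage1.
- move=> S _; rewrite -[_ @^-1` _]setTI; exact: measurable_funP.
Qed.

Lemma mass_proportionalE {R : realType} {n : nat} {d : measure_display}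
    {T : measurableType d} {P : probability T R} {X : {RV P >-> subsets n}}
    {w : {set 'I_n} -> R} : mass_proportional_to X w ->
  \sum_S w S != 0 /\ forall S, mass X S = (w S / \sum_S w S)%:E.
Proof.
case=> c Xw.
have c1 : c * \sum_S w S = 1.
  apply: EFin_inj; rewrite -(sum_mass X) mulr_sumr -sumEFin.
  by apply: eq_bigr => S _; rewrite Xw.
have sum0 : \sum_S w S != 0.
  by apply: contra_eq_neq c1 => ->; rewrite mulr0 eq_sym oner_eq0.
split => // S; rewrite Xw; congr EFin.
by rewrite mulrC; congr (_ * _); rewrite -[LHS](mulfK sum0) c1 mul1r.
Qed.

(** Each weight is a probability times the sum of the weights, and that sum is
    positive since the empty set has weight 1. In this way nonnegativity is read
    off from the existence of the law, without diagonalizing [M]. *)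
Lemma DPP_weight_ge0 {R : realType} {n : nat} {d : measure_display}
    {T : measurableType d} {P : probability T R} {X : {RV P >-> subsets n}}
    {M : 'M[R]_n} :
  mass_proportional_to X (fun S => \det (principal_submx M S)) ->
  forall S, 0 <= \det (principal_submx M S).
Proof.
move=> /mass_proportionalE [sum0 XE] S.
set s := \sum_S _ in sum0 XE.
have mass_ge0 S' : 0 <= \det (principal_submx M S') / s.
  by rewrite -lee_fin -XE; exact: measure_ge0.
have s_ge0 : 0 <= s.
  rewrite -invr_ge0; have := mass_ge0 finset.set0.
  rewrite (_ : \det (principal_submx M finset.set0) = 1) ?mul1r//.
  by move: (principal_submx M finset.set0); rewrite cards0 => N; rewrite det_mx00.
by rewrite -[\det _](mulfVK sum0) mulr_ge0.
Qed.

(** The identity of the set of subsets, under the normalization of the weighted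
    sum of Dirac masses. *)
Lemma exists_mass_proportional_to {R : realType} {n : nat} {w : {set 'I_n} -> R} :
  (forall S, 0 <= w S) -> (exists S, w S != 0) ->
  exists (d : measure_display) (T : measurableType d) (P : probability T R)
    (X : {RV P >-> subsets n}), mass_proportional_to X w.
Proof.
move=> w0 [S1 wS1].
(* Finite sums of measures are indexed by natural numbers, so the subsets are
   numbered; the default [set0] is never reached. *)
pose atom k : {set 'I_n} := nth finset.set0 (enum {set 'I_n}) k.
have [mu muE] : exists mu : {measure set (subsets n) -> \bar R},
    forall U, mu U = (\sum_S (w S)%:E * \d_(S : subsets n) U)%E.
  exists (msum (fun k => mscale (NngNum (w0 (atom k))) \d_(atom k : subsets n))
               #|{set 'I_n}|) => U.
  rewrite -[RHS]big_enum (big_nth finset.set0) big_mkord -cardE.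
  by rewrite /= /msum; apply: eq_bigr.
have muT : mu setT = (\sum_S w S)%:E.
  rewrite muE -sumEFin; apply: eq_bigr => S _.
  by rewrite diracT mule1.
have sum_gt0 : 0 < \sum_S w S.
  rewrite (bigD1 S1)//= ltr_pwDl ?sumr_ge0// lt_neqAle eq_sym wS1.
  exact: w0.
(* The Dirac mass is the fallback for a measure of total mass zero or
   infinite, which [mu] is not. *)
pose P := mnormalize mu (dirac (finset.set0 : subsets n)).
have PE U : P U = (mu U * ((\sum_S w S)^-1)%:E)%E.
  by rewrite /P /mnormalize muT eqe gt_eqF.
pose X : {mfun (subsets n) >-> (subsets n)} :=
  mfun_Sub (mem_set (@measurable_id _ (subsets n) setT) : idfun \in mfun).
exists _, (subsets n), P, X, (\sum_S w S)^-1 => S.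
transitivity (P [set (S : subsets n)]); first by [].
rewrite PE muE (bigD1 S)//= big1 => [|S' S'S].
  by rewrite diracE mem_set// mule1 adde0 -EFinM mulrC.
by rewrite diracE memNset ?mule0// => /eqP; apply/negP.
Qed.

(** * Convergence of the rescaled L-ensembles *)

Theorem proposition3p6 (R : realType) (n p : nat)
    (V : 'M[R]_(n, p)) (A : 'M[R]_n)
    (ltpn : (p < n)%N) (rankV : full_col_rank V)
    (symA : A^T = A) (rankA : \rank A = n)
    (psdA : \forall e \near 0^'+, psd (A + e^-1 *: (V *m V^T)))
    (d : R -> measure_display) (T : forall e : R, measurableType (d e))
    (P : forall e : R, probability (T e) R)
    (X : forall e : R, {RV (P e) >-> subsets n})
    (X_DPP : \forall e \near 0^'+, is_DPP (X e) (A + e^-1 *: (V *m V^T))) :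
  (exists (d' : measure_display) (T' : measurableType d')
     (P' : probability T' R) (X' : {RV P' >-> subsets n}),
     is_partial_projection_DPP X' A V) /\
  (forall (d' : measure_display) (T' : measurableType d')
     (P' : probability T' R) (X' : {RV P' >-> subsets n}),
     is_partial_projection_DPP X' A V -> cvg_in_law_at_0 X X').
Proof.
pose q e S := e ^+ p * \det (principal_submx (A + e^-1 *: (V *m V^T)) S).
pose w S := (-1) ^+ p * \det (bordered_submx A V S).
have q_w S : q e S @[e --> 0^'+] --> w S by exact: cvg_scaled_weight.
split.
  have w_ge0 S : 0 <= w S.
    rewrite -(cvg_lim (@Rhausdorff R) (q_w S)).
    apply: limr_ge; first by apply/cvg_ex; exists (w S); exact: q_w.
    near=> e.
    have [_ X_weights] : is_DPP (X e) (A + e^-1 *: (V *m V^T)) by near: e.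
    apply: mulr_ge0; first by rewrite exprn_ge0.
    exact: (DPP_weight_ge0 X_weights).
  have [S wS] : exists S, w S != 0.
    have [S detS] := exists_det_bordered_neq0 A rankV.
    by exists S; rewrite mulf_neq0// signr_eq0.
  have [d' [T' [P' [X' X'w]]]] := exists_mass_proportional_to w_ge0 (ex_intro _ S wS).
  exists d', T', P', X'; split => //; split => // x Vx.
  have [e [_ psde]] := filter_ex psdA.
  (* The low-rank term vanishes on the kernel of [V^T]. *)
  suff -> : quad_form A x = quad_form (A + e^-1 *: (V *m V^T)) x by exact: psde.
  rewrite /quad_form mulmxDr mulmxDl -scalemxAr -scalemxAl -!mulmxA Vx.
  by rewrite !mulmx0 scaler0 addr0.
move=> d' T' P' X' [_ X'w] S.
have [sumw0 ->] := mass_proportionalE X'w.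
(* Rescaling all weights by [e ^+ p] does not change the normalized law. *)
apply: (@cvg_trans _ ((q e S / \sum_S q e S)%:E @[e --> 0^'+])).
  apply: near_eq_cvg; near=> e.
  have [_ X_weights] : is_DPP (X e) (A + e^-1 *: (V *m V^T)) by near: e.
  have [_ ->] := mass_proportionalE X_weights.
  have e0 : e ^+ p != 0 by rewrite expf_neq0// gt_eqF.
  by rewrite -mulr_sumr -mulf_div divff// mul1r.
apply: cvg_EFin; first by near=> e.
apply: cvgM => //; apply: cvgV => //.
apply: cvg_big => [|S' _]; [exact: add_continuous|exact: q_w].
Unshelve. all: by end_near. Qed.
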